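(* Let $N\ge 1$ be an integer and $\mathcal X=\{0,1,\dots,N\}$. Let $K(x,y)$, $x,y\in\mathcal X$, be a matrix generated by one of the convolutions (i)–(v) listed in the context, where the measures $\pi$ occurring in it all belong to one and the same family (Krawtchouk, Hahn or $q$-Hahn) and their parameters $\lambda_1,\lambda_2$ (and $\lambda_3$) are arbitrary admissible parameters. Put $\eta(x)=x$ if the family is Krawtchouk or Hahn (types (i)–(v) allowed), and $\eta(x)=q^{-x}-1$ if the family is $q$-Hahn (types (i), (iii), (iv) allowed). Then $K$ satisfies the triangularity condition: there are real constants $a_{n,m}$ ($0\le m\le n\le N$), independent of $x$, such that $$\sum_{y\in\mathcal X}K(y,x)\,\eta(y)^n=\sum_{m=0}^{n}a_{n,m}\,\eta(x)^m\qquad(x\in\mathcal X,\ n\in\mathcal X),$$ where $\eta(x)^0=1$; that is, the left-hand side is a polynomial in $\eta(x)$ of degree at most $n$.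
   Context: Notation: $(a)_n=a(a+1)\cdots(a+n-1)$, $(a;q)_n=\prod_{i=0}^{n-1}(1-aq^i)$, and $0<q<1$ is fixed. Measures $\pi(x,M,\lambda)$, defined for integers $M\ge0$ and $0\le x\le M$ (and set to $0$ for other integer arguments): - Krawtchouk, $\lambda=p$, $0<p<1$: $\pi(x,M,p)=\binom{M}{x}p^x(1-p)^{M-x}$. - Hahn, $\lambda=(a,b)$, $a,b>0$: $\pi(x,M,a,b)=\binom{M}{x}\frac{(a)_x(b)_{M-x}}{(a+b)_M}$. - $q$-Hahn, $\lambda=(a,b)$, $0<a<1$, $b<1$: $\pi(x,M,a,b)=\frac{(q;q)_M}{(q;q)_x(q;q)_{M-x}}\frac{(a;q)_x(b;q)_{M-x}a^{M-x}}{(ab;q)_M}$. Convolutions ($x,y\in\mathcal X$): (i) $K(x,y)=\sum_{z=0}^{\min(x,y)}\pi(x-z,N-z,\lambda_2)\,\pi(z,y,\lambda_1)$; (ii) $K(x,y)=\sum_{z=\max(0,x+y-N)}^{\min(x,y)}\pi(x-z,N-y,\lambda_2)\,\pi(z,y,\lambda_1)$; (iii) $K(x,y)=\sum_{z=\max(x,y)}^{N}\pi(x,z,\lambda_2)\,\pi(z-y,N-y,\lambda_1)$; (iv) $K(x,y)=\sum_{z_2=0}^{\min(x,y)}\pi(z_2,y,\lambda_1)\sum_{z_1=\max(x,y)}^{N}\pi(x-z_2,z_1-z_2,\lambda_3)\,\pi(z_1-y,N-y,\lambda_2)$; (v) $K(x,y)=\sum_{z_2=0}^{\min(x,y)}\pi(z_2,y,\lambda_1)\sum_{z_1=x+y-z_2}^{N}\pi(x-z_2,z_1-y,\lambda_3)\,\pi(z_1-y,N-y,\lambda_2)$.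 *)

(* Defs.v *)
From mathcomp Require Import all_boot all_order all_algebra.
From mathcomp Require Import reals.
Set Implicit Arguments.
Unset Strict Implicit.
Unset Printing Implicit Defensive.
Import Order.TTheory GRing.Theory Num.Theory.
Local Open Scope ring_scope.

Definition pochhammer (R : realType) (a : R) (n : nat) : R :=
  \prod_(i < n) (a + i%:R).

Definition qpochhammer (R : realType) (a q : R) (n : nat) : R :=
  \prod_(i < n) (1 - a * q ^+ i).

(* The measures take natural numbers and vanish for x > M.  In every convolution
   below the summation ranges make all subtractions exact, except the lower
   bound [x + y - N] in type (ii), which is truncated to max(0, x + y - N). *)

Definition krawtchouk_measure (R : realType) (p : R) (x M : nat) : R :=
  if (x <= M)%N then 'C(M, x)%:R * p ^+ x * (1 - p) ^+ (M - x) else 0.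

Definition hahn_measure (R : realType) (a b : R) (x M : nat) : R :=
  if (x <= M)%N then
    'C(M, x)%:R *
    (pochhammer a x * pochhammer b (M - x) / pochhammer (a + b) M)
  else 0.

Definition qhahn_measure (R : realType) (q a b : R) (x M : nat) : R :=
  if (x <= M)%N then
    (qpochhammer q q M / (qpochhammer q q x * qpochhammer q q (M - x))) *
    (qpochhammer a q x * qpochhammer b q (M - x) * a ^+ (M - x) /
     qpochhammer (a * b) q M)
  else 0.

Inductive measure_family := Krawtchouk | Hahn | QHahn.

Definition param (R : realType) (F : measure_family) : Type :=
  match F with
  | Krawtchouk => R
  | Hahn | QHahn => (R * R)%type
  end.

Definition admissible (R : realType) (F : measure_family) : param R F -> bool :=
  match F with
  | Krawtchouk => fun p => 0 < p < 1
  | Hahn => fun l => (0 < l.1) && (0 < l.2)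
  | QHahn => fun l => (0 < l.1 < 1) && (l.2 < 1)
  end.

Definition measure (R : realType) (q : R) (F : measure_family) :
    param R F -> nat -> nat -> R :=
  match F with
  | Krawtchouk => fun p => krawtchouk_measure p
  | Hahn => fun l => hahn_measure l.1 l.2
  | QHahn => fun l => qhahn_measure q l.1 l.2
  end.

Definition eta (R : realType) (q : R) (F : measure_family) (x : nat) : R :=
  match F with
  | Krawtchouk | Hahn => x%:R
  | QHahn => q ^- x - 1
  end.

Inductive convolution_type := ConvI | ConvII | ConvIII | ConvIV | ConvV.

Definition allowed (F : measure_family) (c : convolution_type) : bool :=
  match F, c with
  | QHahn, (ConvII | ConvV) => false
  | _, _ => true
  end.

(* Only types (iv) and (v) use the third parameter. *)
Definition kernel (R : realType) (q : R) (F : measure_family) (c : convolution_type)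
    (l1 l2 l3 : param R F) (N x y : nat) : R :=
  let mu := @measure R q F in
  match c with
  | ConvI =>
      \sum_(0 <= z < (minn x y).+1) mu l2 (x - z)%N (N - z)%N * mu l1 z y
  | ConvII =>
      \sum_(x + y - N <= z < (minn x y).+1)
        mu l2 (x - z)%N (N - y)%N * mu l1 z y
  | ConvIII =>
      \sum_(maxn x y <= z < N.+1) mu l2 x z * mu l1 (z - y)%N (N - y)%N
  | ConvIV =>
      \sum_(0 <= z2 < (minn x y).+1) mu l1 z2 y *
        \sum_(maxn x y <= z1 < N.+1)
          mu l3 (x - z2)%N (z1 - z2)%N * mu l2 (z1 - y)%N (N - y)%N
  | ConvV =>
      \sum_(0 <= z2 < (minn x y).+1) mu l1 z2 y *
        \sum_(x + y - z2 <= z1 < N.+1)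
          mu l3 (x - z2)%N (z1 - y)%N * mu l2 (z1 - y)%N (N - y)%N
  end.

(* Main.v *)
Require Import Defs.
From mathcomp Require Import all_boot all_order all_algebra.
From mathcomp Require Import reals.
From mathcomp Require Import ring lra zify.
Import Order.TTheory GRing.Theory Num.Theory.
Local Open Scope ring_scope.

(** Each measure is the law of an urn scheme, which gives total mass one, and its
    size-biased version stays in the family.  Iterating the size bias shows that
    if [y - z] has law [pi(., M - z)], the Newton product of the
    [eta y - eta (z + i)] over [i < k] has expectation a constant times the
    product of the [eta M - eta (z + i)].  Since [eta (z + i)] is affine in
    [eta z], the expectation of [eta y ^+ n] is a polynomial of total degree at
    most [n] in [eta z] and [eta M].  Every convolution is a composition of such
    expectations; types (ii) and (v) moreover need the binomial expansion of
    [eta (z + w)] and the reflection [x |-> N - x], which preserve the degree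
    only for [eta x = x]. *)

(** * Recursions of the shifted factorials *)

Lemma pochhammerS (R : realType) (a : R) n :
  pochhammer a n.+1 = pochhammer a n * (a + n%:R).
Proof. by rewrite /pochhammer big_ord_recr. Qed.

Lemma pochhammerSl (R : realType) (a : R) n :
  pochhammer a n.+1 = a * pochhammer (a + 1) n.
Proof.
rewrite /pochhammer big_ord_recl addr0; congr (_ * _).
by apply: eq_bigr => i _; rewrite -addrA -natr1 [1 + _]addrC.
Qed.

Lemma pochhammer_gt0 (R : realType) (a : R) n : 0 < a -> 0 < pochhammer a n.
Proof. by move=> a0; apply: prodr_gt0 => i _; rewrite ltr_wpDr ?ler0n. Qed.

Lemma qpochhammerS (R : realType) (a q : R) n :
  qpochhammer a q n.+1 = qpochhammer a q n * (1 - a * q ^+ n).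
Proof. by rewrite /qpochhammer big_ord_recr. Qed.

Lemma qpochhammerSl (R : realType) (a q : R) n :
  qpochhammer a q n.+1 = (1 - a) * qpochhammer (a * q) q n.
Proof.
rewrite /qpochhammer big_ord_recl mulr1; congr (_ * _).
by apply: eq_bigr => i _; rewrite -mulrA -exprS.
Qed.

(** * Positivity, urn recursions and total mass *)

Section Measures.
Context (R : realType) (q : R) (q01 : 0 < q < 1).

Lemma qpower_factor_gt0 (a : R) n : a < 1 -> 0 < 1 - a * q ^+ n.
Proof.
move=> a1; rewrite subr_gt0; case/andP: q01 => q0 q1.
have [a0|a0] := ltP 0 a.
  by apply: le_lt_trans a1; rewrite ger_pMr // exprn_ile1 // ltW.
by apply: le_lt_trans ltr01; rewrite mulr_le0_ge0 ?exprn_ge0 // ltW.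
Qed.

Lemma qpochhammer_gt0 (a : R) n : a < 1 -> 0 < qpochhammer a q n.
Proof. by move=> a1; apply: prodr_gt0 => i _; apply: qpower_factor_gt0. Qed.

Lemma qhahn_param_lt1 (a b : R) : 0 < a < 1 -> b < 1 -> a * b < 1.
Proof. by move=> /andP[a0 a1] b1; nra. Qed.

Lemma measure_gt (F : measure_family) (l : param R F) x M :
  (M < x)%N -> measure q l x M = 0.
Proof.
case: F l => l Mx; rewrite /= /krawtchouk_measure /hahn_measure /qhahn_measure;
  by rewrite leqNgt Mx.
Qed.

Lemma measure00 (F : measure_family) (l : param R F) : measure q l 0 0 = 1.
Proof.
case: F l => l; rewrite /= /krawtchouk_measure /hahn_measure /qhahn_measure /=
  ?bin0 ?/pochhammer ?/qpochhammer ?big_ord0 ?expr0; by field.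
Qed.

(* Every family is the law of the number of white draws in a Polya-type urn
   scheme; [u w M] is the probability of drawing white after [w] white draws
   among [M]. *)
Definition urn_recursion (u mu : nat -> nat -> R) :=
  forall M, mu 0 M.+1 = (1 - u 0 M) * mu 0 M /\
  forall w, mu w.+1 M.+1 = u w M * mu w M + (1 - u w.+1 M) * mu w.+1 M.

Lemma krawtchouk_measureE (p : R) w j :
  krawtchouk_measure p w (w + j)%N = 'C(w + j, w)%:R * p ^+ w * (1 - p) ^+ j.
Proof. by rewrite /krawtchouk_measure leq_addr addKn. Qed.

Lemma hahn_measureE (a b : R) w j :
  hahn_measure a b w (w + j)%N = 'C(w + j, w)%:R *
    (pochhammer a w * pochhammer b j / pochhammer (a + b) (w + j)%N).
Proof. by rewrite /hahn_measure leq_addr addKn. Qed.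

Lemma qhahn_measureE (a b : R) w j :
  qhahn_measure q a b w (w + j)%N =
    (qpochhammer q q (w + j)%N / (qpochhammer q q w * qpochhammer q q j)) *
    (qpochhammer a q w * qpochhammer b q j * a ^+ j /
     qpochhammer (a * b) q (w + j)%N).
Proof. by rewrite /qhahn_measure leq_addr addKn. Qed.

(** The boundary [w = M] is separated; for [w < M], writing [M] as [w.+1 + j] removes the truncated
    subtractions, which leaves field identities. *)
Lemma urn_recursionI (u mu : nat -> nat -> R) :
  (forall w M, (M < w)%N -> mu w M = 0) ->
  (forall j, mu 0 j.+1 = (1 - u 0 j) * mu 0 j) ->
  (forall w, mu w.+1 w.+1 = u w w * mu w w) ->
  (forall w j, mu w.+1 (w.+1 + j.+1)%N =
     u w (w + j.+1)%N * mu w (w + j.+1)%N +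
     (1 - u w.+1 (w.+1 + j)%N) * mu w.+1 (w.+1 + j)%N) ->
  urn_recursion u mu.
Proof.
move=> mu0 muj muw muwj M; split=> [|w]; first exact: muj.
have [wM|Mw|->] := ltngtP w M.
- have [j ->] : exists j, M = (w.+1 + j)%N by exists (M - w.+1)%N; lia.
  by rewrite -addnS muwj addSnnS.
- by rewrite !mu0 ?mulr0 ?addr0 //; lia.
- by rewrite muw (mu0 M.+1) ?mulr0 ?addr0.
Qed.

Lemma krawtchouk_urn (p : R) : urn_recursion (fun _ _ => p) (krawtchouk_measure p).
Proof.
apply: urn_recursionI => [w M|j|w|w j].
- exact: (measure_gt Krawtchouk p).
- rewrite /krawtchouk_measure /= !subn0 !bin0 exprS; ring.
- rewrite /krawtchouk_measure !leqnn !subnn !binn exprS; ring.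
- rewrite !krawtchouk_measureE -[(w + j.+1)%N]addSnnS addnS binS natrD !exprS addSn.
  ring.
Qed.

Lemma hahn_urn (a b : R) : 0 < a -> 0 < b ->
  urn_recursion (fun w M => (a + w%:R) / (a + b + M%:R)) (hahn_measure a b).
Proof.
move=> a0 b0.
have D0 M : a + b + M%:R != 0 by rewrite lt0r_neq0 // ltr_wpDr ?ler0n ?addr_gt0.
have P0 M : pochhammer (a + b) M != 0 by rewrite lt0r_neq0 ?pochhammer_gt0 ?addr_gt0.
apply: urn_recursionI => [w M|j|w|w j].
- exact: (measure_gt Hahn (a, b)).
- rewrite /hahn_measure /= !subn0 !bin0 !pochhammerS.
  by field; rewrite D0 P0.
- rewrite /hahn_measure !leqnn !subnn !binn !pochhammerS.
  by field; rewrite D0 P0.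
- rewrite !hahn_measureE -[(w + j.+1)%N]addSnnS addnS.
  have : (w.+1 + j)%:R = w%:R + 1 + j%:R :> R by rewrite natrD natr1.
  move: (w.+1 + j)%N => M eM; have := D0 M; have := P0 M.
  rewrite binS !pochhammerS !natrD -!natr1 eM => P D.
  by field; rewrite D P.
Qed.

(** For [w <= M] the complementary probability is [a * q ^+ w * (1 - b * q ^+ (M - w)) / (1 - a * b
    * q ^+ M)]; its power of [q] is the weight in the q-Pascal rule. *)
Lemma qhahn_urn (a b : R) : 0 < a < 1 -> b < 1 ->
  urn_recursion (fun w M => (1 - a * q ^+ w) / (1 - a * b * q ^+ M))
    (qhahn_measure q a b).
Proof.
move=> a01 b1; have ab1 := qhahn_param_lt1 _ _ a01 b1.
have q1 : q < 1 by case/andP: q01.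
have D0 c n : c < 1 -> 1 - c * q ^+ n != 0.
  by move=> c1; rewrite lt0r_neq0 ?qpower_factor_gt0.
have P0 c n : c < 1 -> qpochhammer c q n != 0.
  by move=> c1; rewrite lt0r_neq0 ?qpochhammer_gt0.
apply: urn_recursionI => [w M|j|w|w j].
- exact: (measure_gt QHahn (a, b)).
- rewrite /qhahn_measure /= !subn0 !qpochhammerS.
  by rewrite exprS; field; rewrite !D0 ?P0.
- rewrite /qhahn_measure !leqnn !subnn !qpochhammerS.
  by field; rewrite !D0 ?P0.
- rewrite !qhahn_measureE -[(w + j.+1)%N]addSnnS addnS.
  have : q ^+ (w.+1 + j) = q * q ^+ w * q ^+ j by rewrite exprD exprS.
  move: (w.+1 + j)%N => M eM; have := D0 _ M ab1; have := P0 _ M ab1.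
  have := D0 _ w q1; have := D0 _ j q1; have := P0 _ w q1; have := P0 _ j q1.
  rewrite !qpochhammerS !exprS eM => P1 P2 P3 P4 P5 P6.
  by field; rewrite P1 P2 P3 P4 P5 P6.
Qed.

Lemma measure_urn (F : measure_family) (l : param R F) : admissible l ->
  exists u, urn_recursion u (measure q l).
Proof.
case: F l => [p _|[a b] /andP[a0 b0]|[a b] /andP[a01 b1]].
- by eexists; exact: krawtchouk_urn.
- by eexists; exact: hahn_urn.
- by eexists; exact: qhahn_urn.
Qed.

(** Passing from [M] to [M.+1] moves the fraction [u w M] of the mass at [w] to [w.+1] and keeps the
    rest at [w], so the total is preserved. *)
Lemma sum_measure (F : measure_family) (l : param R F) M : admissible l ->
  \sum_(0 <= w < M.+1) measure q l w M = 1.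
Proof.
move=> /measure_urn [u urn]; elim: M => [|M IH].
  by rewrite big_nat1 measure00.
have [mu0 muS] := urn M.
rewrite big_nat_recl //= mu0 (eq_bigr _ (fun i _ => muS i)) big_split /=.
(* The kept fractions are regrouped into one sum, whose last term, at [M.+1], vanishes. *)
rewrite addrCA -(@big_nat_recl _ _ _ _ _ (fun i => (1 - u i M) * measure q l i M)) //.
rewrite [X in _ + X]big_nat_recr //= [measure q l M.+1 M]measure_gt //.
rewrite mulr0 addr0 -big_split -[RHS]IH /=.
by apply: eq_bigr => i _; ring.
Qed.

(** * Size bias *)

(** For [eta x = x] the factor [w.+1] is absorbed by the binomial, and splitting off the first
    factor of [pochhammer a w.+1] shifts [a] to [a + 1]. For q-Hahn, [1 - q ^+ w.+1] cancels in
    [qpochhammer q q w.+1], and the leftover [q ^+ (M - w)] turns [a ^+ (M - w)] into a power of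
    [a * q]. Summing over [w] shows that [c] is the mean of [eta] divided by [eta] at [M.+1]. *)
Lemma measure_size_bias (F : measure_family) (l : param R F) : admissible l ->
  exists (c : R) (l' : param R F), admissible l' /\
    forall w M, measure q l w.+1 M.+1 * eta q F w.+1 =
      c * eta q F M.+1 * measure q l' w M.
Proof.
have red (mu mu' : nat -> nat -> R) (e : nat -> R) c :
    (forall w M, (M < w)%N -> mu w M = 0) ->
    (forall w M, (M < w)%N -> mu' w M = 0) ->
    (forall w j, mu w.+1 (w.+1 + j)%N * e w.+1 =
       c * e (w + j)%N.+1 * mu' w (w + j)%N) ->
    forall w M, mu w.+1 M.+1 * e w.+1 = c * e M.+1 * mu' w M.
  move=> m0 m0' H w M; have [wM|Mw] := leqP w M.
    by have := H w (M - w)%N; rewrite addSn subnKC.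
  by rewrite m0 // m0' // mul0r mulr0.
have bin_shift w j :
    'C(w.+1 + j, w.+1)%:R * w.+1%:R = (w + j)%N.+1%:R * 'C(w + j, w)%:R :> R.
  by rewrite -!natrM mulnC -mul_bin_diag.
case: F l => [p|[a b]|[a b]] /= hl.
- exists p, p; split=> //; apply: red => [w M|w M|w j].
  + exact: (measure_gt Krawtchouk p).
  + exact: (measure_gt Krawtchouk p).
  rewrite !krawtchouk_measureE mulrAC [X in X * _]mulrAC bin_shift exprS.
  by move: (w + j)%N.+1%:R 'C(w + j, w)%:R => M C; ring.
- case/andP: hl => a0 b0.
  exists (a / (a + b)), (a + 1, b); split; first by rewrite /= addr_gt0.
  apply: red => [w M|w M|w j].
  + exact: (measure_gt Hahn (a, b)).
  + exact: (measure_gt Hahn (a + 1, b)).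
  rewrite !hahn_measureE mulrAC bin_shift addSn !pochhammerSl [a + 1 + b]addrAC.
  have : pochhammer (a + b + 1) (w + j) != 0.
    by rewrite lt0r_neq0 ?pochhammer_gt0 ?addr_gt0.
  have : a + b != 0 by rewrite lt0r_neq0 ?addr_gt0.
  move: (w + j)%N.+1%:R 'C(w + j, w)%:R (pochhammer (a + b + 1) _) => M C P ab0 P0.
  by field; rewrite P0.
- case/andP: hl => a01 b1; case/andP: (a01) => a0 a1; case/andP: (q01) => q0 q1.
  have aq01 : 0 < a * q < 1 by rewrite mulr_gt0 //= mulr_ilt1 // ltW.
  exists ((1 - a) / (1 - a * b)), (a * q, b); split; first by rewrite /= aq01.
  apply: (red _ _ (eta q QHahn)) => [w M|w M|w j].
  + exact: (measure_gt QHahn (a, b)).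
  + exact: (measure_gt QHahn (a * q, b)).
  rewrite !qhahn_measureE addSn [qpochhammer q q _.+1]qpochhammerS.
  rewrite [qpochhammer q q w.+1]qpochhammerS.
  rewrite /eta !qpochhammerSl [a * q * b]mulrAC exprMn !exprS exprD.
  have abq1 := qhahn_param_lt1 _ _ aq01 b1; rewrite mulrAC in abq1.
  have := qpochhammer_gt0 _ (w + j) abq1; have := qpochhammer_gt0 _ j q1.
  have := qpochhammer_gt0 _ w q1; have := qpower_factor_gt0 _ w q1.
  have := qpower_factor_gt0 _ 0 (qhahn_param_lt1 _ _ a01 b1); rewrite expr0 mulr1.
  have := exprn_gt0 w q0; have := exprn_gt0 j q0; have := q0.
  move=> /lt0r_neq0 P1 /lt0r_neq0 P2 /lt0r_neq0 P3 /lt0r_neq0 P4 /lt0r_neq0 P5.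
  move=> /lt0r_neq0 P6 /lt0r_neq0 P7 /lt0r_neq0.
  move: (qpochhammer q q (w + j)) (qpochhammer (a * b * q) _ (w + j)) => A B P8.
  by field; rewrite P1 P2 P3 P4 P5 P6 P7 P8.
Qed.

(** * Newton products and their expectations *)

Section Expectation.
Context (F : measure_family).
Implicit Types (l : param R F) (f : nat -> R) (g : nat -> nat -> R).

(** The slope of the affine map taking [eta y] to [eta (z + y)]. *)
Definition eta_scale z : R := if F is QHahn then q ^- z else 1.

Lemma eta_add z y : eta q F (z + y) = eta_scale z * eta q F y + eta q F z.
Proof.
rewrite /eta_scale; case: F => /=; rewrite ?natrD; try ring.
by rewrite exprD invfM; ring.
Qed.

Lemma eta0 : eta q F 0 = 0.
Proof. by case: F => //=; rewrite expr0 invr1 subrr. Qed.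

(** Newton's interpolation product; a falling factorial when [eta x = x] and [z = 0]. *)
Definition newton k z y : R := \prod_(i < k) (eta q F y - eta q F (z + i)).

Lemma newtonS k z y : newton k.+1 z y = newton k z y * (eta q F y - eta q F (z + k)).
Proof. by rewrite /newton big_ord_recr. Qed.

Lemma newtonSl k z y : newton k.+1 z y = (eta q F y - eta q F z) * newton k z.+1 y.
Proof.
rewrite /newton big_ord_recl addn0; congr (_ * _).
by apply: eq_bigr => i _; rewrite addSnnS.
Qed.

Lemma newton_add k z w : newton k z (z + w) = eta_scale z ^+ k * newton k 0 w.
Proof.
rewrite -[k in _ ^+ k]card_ord -prodr_const -big_split.
by apply: eq_bigr => i _; rewrite /= !eta_add; ring.
Qed.

(* [expect l f z M] averages [f (z + w)] over [w] distributed as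
   [measure q l w (M - z)]. *)
Definition expect l f z M : R :=
  \sum_(z <= y < M.+1) measure q l (y - z) (M - z) * f y.

Lemma expect_add l f z w :
  expect l f z (z + w) = expect l (fun y => f (z + y)%N) 0 w.
Proof.
rewrite /expect addKn subn0 -addnS -{1}[z]add0n big_addn addKn.
by apply: eq_bigr => i _; rewrite addnK subn0 addnC.
Qed.

Lemma eq_expect l f f' z M :
  (forall y, (z <= y <= M)%N -> f y = f' y) -> expect l f z M = expect l f' z M.
Proof. by move=> ff'; apply: eq_big_nat => y yzM; rewrite ff'. Qed.

Lemma expectD l f f' z M :
  expect l (fun y => f y + f' y) z M = expect l f z M + expect l f' z M.
Proof. by rewrite -big_split; apply: eq_bigr => y _; rewrite mulrDr. Qed.

Lemma expectZ l c f z M : expect l (fun y => c * f y) z M = c * expect l f z M.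
Proof. by rewrite /expect big_distrr; apply: eq_bigr => y _; rewrite mulrCA. Qed.

Lemma expect_sum l n (f : nat -> nat -> R) z M :
  expect l (fun y => \sum_(i < n) f i y) z M = \sum_(i < n) expect l (f i) z M.
Proof.
elim: n => [|n IH].
  rewrite big_ord0; under eq_expect do rewrite big_ord0 -(mulr0 0).
  by rewrite expectZ mul0r.
by rewrite big_ord_recr /= -IH -expectD; apply: eq_expect => y _; rewrite big_ord_recr.
Qed.

(** Induction on [k]: size bias absorbs the factor [eta y], and after the shift [y = w.+1] the other
    [k] factors form the product of order [k] at [w], up to [eta_scale 1 ^+ k]. The same power
    appears at [M], so the constants simply multiply. *)
Lemma expect_newton0 l k : admissible l ->
  exists c, forall M, expect l (newton k 0) 0 M = c * newton k 0 M.
Proof.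
elim: k l => [|k IH] l hl.
  exists 1 => M; rewrite /newton big_ord0 mulr1 -[RHS](sum_measure _ l M hl).
  by apply: eq_bigr => i _; rewrite big_ord0 mulr1 !subn0.
have [c [l' [hl' bias]]] := measure_size_bias _ l hl.
have [c' Ec'] := IH _ hl'.
have newton00 : newton k.+1 0 0 = 0 by rewrite newtonSl subrr mul0r.
(* At [M = 0] both sides contain the factor [eta 0 - eta 0]. *)
exists (c * c') => -[|M]; first by rewrite /expect big_nat1 newton00 !mulr0.
rewrite /expect big_nat_recl // newton00 mulr0 add0r newtonSl eta0 subr0.
rewrite -[M.+1 in RHS]add1n newton_add.
transitivity (c * eta q F M.+1 * eta_scale 1 ^+ k * expect l' (newton k 0) 0 M).
  rewrite -expectZ; apply: eq_bigr => w _.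
  rewrite !subn0 newtonSl eta0 subr0 -{2}[w.+1]add1n newton_add mulrA bias; ring.
by rewrite Ec' add1n; ring.
Qed.

(** Translation to base point 0 yields [eta_scale z ^+ k] on both sides, so [c] is independent of
    [z]. *)
Lemma expect_newton l k : admissible l ->
  exists c, forall z M, (z <= M)%N -> expect l (newton k z) z M = c * newton k z M.
Proof.
move=> /(expect_newton0 _ k) [c Ec]; exists c => z M /subnKC <-.
rewrite expect_add; under eq_expect do rewrite newton_add.
by rewrite expectZ Ec newton_add mulrCA.
Qed.

(** * Total degree of expectations in [eta z] and [eta M] *)

(** A bivariate polynomial presented as a sum of monomials, so that later claims reduce by induction
    to a single monomial. *)
Inductive bidegree_le n g : Prop :=
| BidegMono c i j : (i + j <= n)%N ->
    (forall z M, (z <= M)%N -> g z M = c * eta q F z ^+ i * eta q F M ^+ j) ->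
    bidegree_le n g
| BidegAdd g1 g2 : bidegree_le n g1 -> bidegree_le n g2 ->
    (forall z M, (z <= M)%N -> g z M = g1 z M + g2 z M) -> bidegree_le n g.

Lemma eq_bidegree_le n g g' : (forall z M, (z <= M)%N -> g z M = g' z M) ->
  bidegree_le n g -> bidegree_le n g'.
Proof.
move=> gg' [c i j ijn E|g1 g2 H1 H2 E].
  by apply: (BidegMono _ _ c i j ijn) => z M zM; rewrite -gg' ?E.
by apply: (BidegAdd _ _ g1 g2 H1 H2) => z M zM; rewrite -gg' ?E.
Qed.

Lemma bidegree_le_affine n a b c g : bidegree_le n g ->
  bidegree_le n.+1 (fun z M => (a * eta q F z + b * eta q F M + c) * g z M).
Proof.
elim=> {}g => [d i j ijn E|g1 g2 _ H1 _ H2 E]; last first.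
  by apply: (BidegAdd _ _ _ _ H1 H2) => z M zM; rewrite E // mulrDr.
apply: (BidegAdd _ _
  (fun z M => a * d * eta q F z ^+ i.+1 * eta q F M ^+ j +
              b * d * eta q F z ^+ i * eta q F M ^+ j.+1)
  (fun z M => c * d * eta q F z ^+ i * eta q F M ^+ j)).
- apply: BidegAdd => [||z M zM]; last reflexivity.
  + by apply: (BidegMono _ _ (a * d) i.+1 j); first lia.
  + by apply: (BidegMono _ _ (b * d) i j.+1); first lia.
- by apply: (BidegMono _ _ (c * d) i j); first lia.
- by move=> z M zM; rewrite E // !exprS; ring.
Qed.

Lemma bidegree_leZ n c g : bidegree_le n g -> bidegree_le n (fun z M => c * g z M).
Proof.
elim=> {}g => [d i j ijn E|g1 g2 _ H1 _ H2 E]; last first.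
  by apply: (BidegAdd _ _ _ _ H1 H2) => z M zM; rewrite E // mulrDr.
by apply: (BidegMono _ _ (c * d) i j) => // z M zM; rewrite E // !mulrA.
Qed.

Lemma newton_bidegree k : bidegree_le k (newton k).
Proof.
elim: k => [|k IH].
  by apply: (BidegMono _ _ 1 0 0) => // z M _; rewrite /newton big_ord0 !expr0 !mulr1.
have := bidegree_le_affine _ (- eta_scale k) 1 (- eta q F k) _ IH.
(* Writing [z + k] as [k + z] makes the slope [eta_scale k], a constant in [z]. *)
by apply: eq_bidegree_le => z M _; rewrite newtonS [(z + k)%N]addnC eta_add; ring.
Qed.

(* Expanding [eta y] around the node [eta (z + k)] trades a power of [eta]
   for a Newton factor, whose expectation is explicit. *)
Lemma expect_bidegree l m k : admissible l ->
  bidegree_le (m + k)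
    (fun z M => expect l (fun y => eta q F y ^+ m * newton k z y) z M).
Proof.
move=> hl; elim: m k => [|m IH] k.
  have [c Ec] := expect_newton _ k hl.
  apply: eq_bidegree_le (bidegree_leZ _ c _ (newton_bidegree k)) => z M zM /=.
  by rewrite -Ec //; apply: eq_expect => y _; rewrite mul1r.
have := bidegree_le_affine _ (eta_scale k) 0 (eta q F k) _ (IH k).
have := IH k.+1; rewrite addnS addSn => H1 H2.
apply: (BidegAdd _ _ _ _ H1 H2) => z M _.
rewrite -expectZ -expectD; apply: eq_expect => y _.
by rewrite newtonS [(z + k)%N]addnC eta_add exprS; ring.
Qed.

Lemma expect_eta_bidegree l n : admissible l ->
  bidegree_le n (fun z M => expect l (fun y => eta q F y ^+ n) z M).
Proof.
move=> /(expect_bidegree _ n 0); rewrite addn0; apply: eq_bidegree_le => z M _.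
by apply: eq_expect => y _; rewrite /newton big_ord0 mulr1.
Qed.

(** * Degree in [eta x] for [x] up to [N] *)

Section Degree.
Context (N : nat).

Definition degree_le n f : Prop :=
  exists2 p : {poly R}, (size p <= n.+1)%N &
    forall x, (x <= N)%N -> f x = p.[eta q F x].

Lemma eq_degree_le n f f' : (forall x, (x <= N)%N -> f x = f' x) ->
  degree_le n f -> degree_le n f'.
Proof. by move=> ff' [p sp fp]; exists p => // x xN; rewrite -ff' ?fp. Qed.

Lemma degree_leW m n f : (m <= n)%N -> degree_le m f -> degree_le n f.
Proof. by move=> mn [p sp fp]; exists p => //; apply: leq_trans sp _. Qed.

Lemma degree_leD n f f' : degree_le n f -> degree_le n f' ->
  degree_le n (fun x => f x + f' x).
Proof.
move=> [p sp fp] [p' sp' fp']; exists (p + p') => [|x xN].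
  by rewrite (leq_trans (size_polyD _ _)) // geq_max sp.
by rewrite hornerD fp ?fp'.
Qed.

Lemma degree_leM m n f f' : degree_le m f -> degree_le n f' ->
  degree_le (m + n) (fun x => f x * f' x).
Proof.
move=> [p sp fp] [p' sp' fp']; exists (p * p') => [|x xN]; last first.
  by rewrite hornerM fp ?fp'.
by apply: leq_trans (size_polyMleq _ _) _; lia.
Qed.

Lemma degree_leC n c : degree_le n (fun=> c).
Proof.
by exists c%:P => [|x _]; rewrite ?hornerC // (leq_trans (size_polyC_leq1 _)).
Qed.

Lemma degree_leZ n c f : degree_le n f -> degree_le n (fun x => c * f x).
Proof. exact: degree_leM (degree_leC 0 c). Qed.

Lemma degree_le_sum n m (f : nat -> nat -> R) :
  (forall i, (i < m)%N -> degree_le n (f i)) ->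
  degree_le n (fun x => \sum_(i < m) f i x).
Proof.
elim: m => [|m IH] H.
  by apply: eq_degree_le (degree_leC n 0) => x _; rewrite big_ord0.
apply: eq_degree_le (degree_leD _ _ _ (IH _) (H m _)) => // [x _|i im].
  by rewrite big_ord_recr.
by apply: H; apply: ltnW.
Qed.

Lemma degree_leX n : degree_le n (fun x => eta q F x ^+ n).
Proof. by exists 'X^n => [|x _]; rewrite ?size_polyXn // hornerXn. Qed.

Lemma degree_le_ind (P : (nat -> R) -> Prop) n f :
  (forall f f', (forall x, (x <= N)%N -> f x = f' x) -> P f -> P f') ->
  (forall (f : nat -> nat -> R) m, (forall i, (i < m)%N -> P (f i)) ->
     P (fun x => \sum_(i < m) f i x)) ->
  (forall c i, (i <= n)%N -> P (fun x => c * eta q F x ^+ i)) ->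
  degree_le n f -> P f.
Proof.
move=> Pext Psum Pmono [p sp fp].
apply: (Pext (fun x => \sum_(i < n.+1) p`_i * eta q F x ^+ i)).
  by move=> x xN; rewrite fp // (horner_coef_wide _ sp).
by apply: (Psum (fun i x => p`_i * eta q F x ^+ i)) => i; apply: Pmono.
Qed.

Lemma bidegree_lel n g : bidegree_le n g -> degree_le n (g^~ N).
Proof.
elim=> {}g => [c i j ijn E|g1 g2 _ H1 _ H2 E]; last first.
  by apply: eq_degree_le (degree_leD _ _ _ H1 H2) => x xN; rewrite E.
apply: (degree_leW i); first by lia.
apply: eq_degree_le (degree_leZ _ (c * eta q F N ^+ j) _ (degree_leX i)) => x xN.
by rewrite E // mulrAC.
Qed.

Lemma bidegree_ler n g : bidegree_le n g -> degree_le n (g 0).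
Proof.
elim=> {}g => [c i j ijn E|g1 g2 _ H1 _ H2 E]; last first.
  by apply: eq_degree_le (degree_leD _ _ _ H1 H2) => x xN; rewrite E.
apply: (degree_leW j); first by lia.
by apply: eq_degree_le (degree_leZ _ (c * eta q F 0 ^+ i) _
  (degree_leX j)) => x xN; rewrite E.
Qed.

(** By linearity a power of [eta] suffices; its average has bounded total degree in [eta x] and the
    constant [eta N]. *)
Lemma expect_degreel l n f : admissible l -> degree_le n f ->
  degree_le n (fun x => expect l f x N).
Proof.
move=> hl; apply: (degree_le_ind (fun f => degree_le n (fun x => expect l f x N)))
  => [{}f f' ff'|{}f m H|c i im].
- by apply: eq_degree_le => x _; apply: eq_expect => y /andP[_ /ff'].
- by apply: eq_degree_le (degree_le_sum _ _ _ H) => x _; rewrite -expect_sum.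
apply: eq_degree_le (degree_leZ _ c _ (degree_leW _ _ _ im
  (bidegree_lel _ _ (expect_eta_bidegree _ i hl)))) => x _.
by rewrite expectZ.
Qed.

Lemma expect_degreer l n f : admissible l -> degree_le n f ->
  degree_le n (fun x => expect l f 0 x).
Proof.
move=> hl; apply: (degree_le_ind (fun f => degree_le n (fun x => expect l f 0 x)))
  => [{}f f' ff'|{}f m H|c i im].
- by apply: eq_degree_le => x xN; apply: eq_expect => y yx; apply: ff'; lia.
- by apply: eq_degree_le (degree_le_sum _ _ _ H) => x _; rewrite -expect_sum.
apply: eq_degree_le (degree_leZ _ c _ (degree_leW _ _ _ im
  (bidegree_ler _ _ (expect_eta_bidegree _ i hl)))) => x _.
by rewrite expectZ.
Qed.

(** On a monomial the double expectation factors, since the two averages are independent given [x];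
    the degrees [i] and [j] add. *)
Lemma expect2_degree l1 l2 n g : admissible l1 -> admissible l2 -> bidegree_le n g ->
  degree_le n (fun x => expect l1 (fun z => expect l2 (g z) x N) 0 x).
Proof.
move=> hl1 hl2; elim=> {}g => [c i j ijn E|g1 g2 _ H1 _ H2 E].
  apply: (degree_leW (i + j)) => //.
  apply: eq_degree_le (degree_leZ _ c _ (degree_leM _ _ _ _
    (expect_degreer _ _ _ hl1 (degree_leX i))
    (expect_degreel _ _ _ hl2 (degree_leX j)))) => x xN.
  rewrite [X in c * X]mulrC -!expectZ; apply: eq_expect => z zx.
  rewrite mulrCA mulrC -mulrA -!expectZ; apply: eq_expect => y xy.
  by rewrite E; [ring | lia].
apply: eq_degree_le (degree_leD _ _ _ H1 H2) => x xN.
rewrite -expectD; apply: eq_expect => z zx; rewrite -expectD.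
by apply: eq_expect => y xy; rewrite E //; lia.
Qed.

(** For [eta x = x] the reflection is the substitution of [N - X]. *)
Lemma degree_le_reflect n f : F <> QHahn -> degree_le n f ->
  degree_le n (fun x => f (N - x)%N).
Proof.
move=> FQ [p sp fp]; exists (p \Po (N%:R%:P - 'X)) => [|x xN].
  by rewrite size_comp_poly2 // -opprB size_polyN size_XsubC.
have etaE x' : eta q F x' = x'%:R by case: F FQ.
by rewrite fp ?leq_subr // horner_comp hornerD hornerN hornerC hornerX !etaE natrB.
Qed.

Lemma eta_add_expn n z w : F <> QHahn ->
  eta q F (z + w) ^+ n =
  \sum_(i < n.+1) 'C(n, i)%:R * eta q F z ^+ (n - i) * eta q F w ^+ i.
Proof.
move=> FQ; have -> : eta q F (z + w) = eta q F z + eta q F w.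
  by case: F FQ => //= _; rewrite natrD.
by rewrite exprDn; apply: eq_bigr => i _; rewrite -mulrA mulr_natl.
Qed.

(** [T] stands for the one- or two-stage average over [w] in types (ii) and (v). The binomial
    expansion separates [z] from [w], giving products of degree at most [(n - i) + i]. *)
Lemma additive_degree l n (T : (nat -> R) -> nat -> R) :
  F <> QHahn -> admissible l ->
  (forall i, degree_le i (T (fun w => eta q F w ^+ i))) ->
  (forall z M, T (fun w => eta q F (z + w) ^+ n) M =
     \sum_(i < n.+1) 'C(n, i)%:R * eta q F z ^+ (n - i) *
       T (fun w => eta q F w ^+ i) M) ->
  degree_le n
    (fun x => expect l (fun z => T (fun w => eta q F (z + w) ^+ n) (N - x)%N) 0 x).
Proof.
move=> FQ hl Tdeg TE.
pose t i x := 'C(n, i)%:R * (expect l (fun z => eta q F z ^+ (n - i)) 0 x *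
  T (fun w => eta q F w ^+ i) (N - x)%N).
have tdeg i : (i < n.+1)%N -> degree_le n (t i).
  rewrite ltnS => /subnK {1}<-; apply/degree_leZ/degree_leM.
    exact: expect_degreer _ (degree_leX _).
  exact: degree_le_reflect (Tdeg i).
apply: eq_degree_le (degree_le_sum _ _ _ tdeg) => x xN.
symmetry; under eq_expect do rewrite TE.
rewrite [LHS](expect_sum _ _ (fun i z => 'C(n, i)%:R * eta q F z ^+ (n - i) *
  T (fun w => eta q F w ^+ i) (N - x)%N)); apply: eq_bigr => i _.
by rewrite /t mulrCA mulrC -expectZ; apply: eq_expect => z _; ring.
Qed.

End Degree.
End Expectation.

(** * Kernel sums as compositions of expectations *)

Lemma big_nat_restrict a b B (G : nat -> R) :
  (forall z, (a <= z < b)%N -> (z < B)%N) ->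
  \sum_(a <= z < b) G z = \sum_(0 <= z < B | (a <= z < b)%N) G z.
Proof.
move=> abB; rewrite (big_nat_widenl _ 0) // (big_nat_widen _ _ (maxn b B)) ?leq_maxl //.
rewrite [RHS](big_nat_widen _ _ (maxn b B)) ?leq_maxr //.
by apply: eq_bigl => z; apply/idP/idP => H; have := abB z; lia.
Qed.

Lemma exchange_big_nat_region m n m' n' (a b c d : nat -> nat) (G : nat -> nat -> R) :
  (forall y z, (m <= y < n)%N && (a y <= z < b y)%N =
               (m' <= z < n')%N && (c z <= y < d z)%N) ->
  \sum_(m <= y < n) \sum_(a y <= z < b y) G y z =
  \sum_(m' <= z < n') \sum_(c z <= y < d z) G y z.
Proof.
move=> E.
transitivity (\sum_(m <= y < n)
    \sum_(0 <= z < n' | (m <= y < n)%N && (a y <= z < b y)%N) G y z).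
  apply: eq_big_nat => y yn; rewrite (big_nat_restrict _ _ n') => [|z zy].
    by apply: eq_bigl => z; rewrite yn.
  by have := E y z; rewrite yn zy => /esym/andP[/andP[]].
transitivity (\sum_(m' <= z < n')
    \sum_(0 <= y < n | (m' <= z < n')%N && (c z <= y < d z)%N) G y z); last first.
  apply: eq_big_nat => z zn; rewrite [RHS](big_nat_restrict _ _ n) => [|y yz].
    by apply: eq_bigl => y; rewrite zn.
  by have := E y z; rewrite zn yz => /andP[/andP[]].
rewrite (big_nat_widenl _ 0) // [RHS](big_nat_widenl _ 0) //.
rewrite (exchange_big_dep_nat (fun z => m' <= z)%N) /= => [|y z _ _ _].
  apply: eq_bigr => z mz; apply: eq_bigl => y; rewrite -E.
  by case: (m <= y)%N.
by rewrite E => /andP[/andP[]].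
Qed.

(** Two-step transition: [z] is drawn in [[0, x]], then [y] in [[z, N]]. *)
Lemma sum_kernelI F (l1 l2 l3 : param R F) N x (f : nat -> R) : (x <= N)%N ->
  \sum_(y < N.+1) kernel q ConvI l1 l2 l3 N y x * f y =
  expect F l1 (fun z => expect F l2 f z N) 0 x.
Proof.
move=> xN; rewrite -(big_mkord xpredT (fun y => kernel q ConvI l1 l2 l3 N y x * f y)).
under eq_bigr do rewrite /kernel big_distrl.
rewrite (exchange_big_nat_region _ _ 0 x.+1 _ _ id (fun=> N.+1)) => [|y z]; last by lia.
apply: eq_bigr => z _; rewrite big_distrr; apply: eq_bigr => y _.
by rewrite /= !subn0; ring.
Qed.

Lemma sum_kernelII F (l1 l2 l3 : param R F) N x (f : nat -> R) : (x <= N)%N ->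
  \sum_(y < N.+1) kernel q ConvII l1 l2 l3 N y x * f y =
  expect F l1 (fun z => expect F l2 (fun w => f (z + w)%N) 0 (N - x)) 0 x.
Proof.
move=> xN; rewrite -(big_mkord xpredT (fun y => kernel q ConvII l1 l2 l3 N y x * f y)).
under eq_bigr do rewrite /kernel big_distrl.
(* As [x <= N], the truncated bound [y + x - N <= z] means [y <= z + (N - x)]. *)
rewrite (exchange_big_nat_region _ _ 0 x.+1 _ _ id (fun z => (z + (N - x)).+1)%N)
  => [|y z]; last by lia.
apply: eq_bigr => z _; rewrite -expect_add big_distrr; apply: eq_bigr => y _.
by rewrite /= !subn0 addKn; ring.
Qed.

Lemma sum_kernelIII F (l1 l2 l3 : param R F) N x (f : nat -> R) : (x <= N)%N ->
  \sum_(y < N.+1) kernel q ConvIII l1 l2 l3 N y x * f y =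
  expect F l1 (fun z => expect F l2 f 0 z) x N.
Proof.
move=> xN; rewrite -(big_mkord xpredT (fun y => kernel q ConvIII l1 l2 l3 N y x * f y)).
under eq_bigr do rewrite /kernel big_distrl.
rewrite (exchange_big_nat_region _ _ x N.+1 _ _ (fun=> 0) succn) => [|y z]; last by lia.
apply: eq_bigr => z _; rewrite big_distrr; apply: eq_bigr => y _.
by rewrite /= !subn0; ring.
Qed.

(** Given [x], [z2] in [[0, x]] and [z1] in [[x, N]] are drawn independently, then [y] in
    [[z2, z1]]. *)
Lemma sum_kernelIV F (l1 l2 l3 : param R F) N x (f : nat -> R) : (x <= N)%N ->
  \sum_(y < N.+1) kernel q ConvIV l1 l2 l3 N y x * f y =
  expect F l1 (fun z2 => expect F l2 (fun z1 => expect F l3 f z2 z1) x N) 0 x.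
Proof.
move=> xN; rewrite -(big_mkord xpredT (fun y => kernel q ConvIV l1 l2 l3 N y x * f y)).
under eq_bigr do rewrite /kernel big_distrl.
rewrite (exchange_big_nat_region _ _ 0 x.+1 _ _ id (fun=> N.+1)) => [|y z]; last by lia.
apply: eq_big_nat => z2 z2x.
under eq_bigr do rewrite /= -mulrA big_distrl.
rewrite -big_distrr !subn0; congr (_ * _) => /=.
rewrite (exchange_big_nat_region _ _ x N.+1 _ _ (fun=> z2) succn)
  => [|y z]; last by lia.
apply: eq_bigr => z1 _; rewrite big_distrr; apply: eq_bigr => y _.
by rewrite /= mulrAC mulrC.
Qed.

Lemma sum_kernelV F (l1 l2 l3 : param R F) N x (f : nat -> R) : (x <= N)%N ->
  \sum_(y < N.+1) kernel q ConvV l1 l2 l3 N y x * f y =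
  expect F l1 (fun z2 => expect F l2
    (fun u => expect F l3 (fun w => f (z2 + w)%N) 0 u) 0 (N - x)) 0 x.
Proof.
move=> xN; rewrite -(big_mkord xpredT (fun y => kernel q ConvV l1 l2 l3 N y x * f y)).
under eq_bigr do rewrite /kernel big_distrl.
rewrite (exchange_big_nat_region _ _ 0 x.+1 _ _ id (fun=> N.+1)) => [|y z]; last by lia.
apply: eq_big_nat => z2 z2x.
under eq_bigr do rewrite /= -mulrA big_distrl.
rewrite -big_distrr !subn0; congr (_ * _) => /=.
rewrite (exchange_big_nat_region _ _ x N.+1 _ _ (fun=> z2)
  (fun z1 => (z2 + (z1 - x)).+1))
  => [|y z]; last by lia.
transitivity (expect F l2
  (fun z1 => expect F l3 (fun w => f (z2 + w)%N) 0 (z1 - x)) x N).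
  apply: eq_bigr => z1 _; rewrite -expect_add big_distrr; apply: eq_bigr => y _.
  by rewrite /= addKn mulrAC mulrC.
(* The substitution [z1 = x + u] moves the average from [[x, N]] to [[0, N - x]]. *)
rewrite -{1}(subnKC xN) expect_add; apply: eq_expect => u _.
by rewrite addKn.
Qed.

(** * Triangularity for the five types *)

Lemma sum_kernel_degree F (c : convolution_type) (l1 l2 l3 : param R F) N n :
  allowed F c -> admissible l1 -> admissible l2 -> admissible l3 ->
  degree_le F N n
    (fun x => \sum_(y < N.+1) kernel q c l1 l2 l3 N y x * eta q F y ^+ n).
Proof.
move=> hFc hl1 hl2 hl3.
have FQ : c = ConvII \/ c = ConvV -> F <> QHahn.
  by move=> cE FQ; move: hFc; rewrite FQ; case: cE => ->.
pose f y := eta q F y ^+ n.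
case: c FQ {hFc} => FQ.
- apply: (eq_degree_le _ _ _ _ _ (fun x xN => esym (sum_kernelI F l1 l2 l3 N x f xN))).
  apply: expect_degreer => //; apply: expect_degreel => //; exact: degree_leX.
- apply: (eq_degree_le _ _ _ _ _ (fun x xN => esym (sum_kernelII F l1 l2 l3 N x f xN))).
  have {}FQ := FQ (or_introl erefl).
  apply: (additive_degree F N l1 n (fun f x => expect F l2 f 0 x)) => //.
    by move=> i; apply: expect_degreer => //; exact: degree_leX.
  move=> z M; under eq_expect do rewrite eta_add_expn //.
  rewrite [LHS](expect_sum _ _ _ (fun i w =>
    'C(n, i)%:R * eta q F z ^+ (n - i) * eta q F w ^+ i)).
  by apply: eq_bigr => i _; rewrite -expectZ.
- apply: (eq_degree_le _ _ _ _ _ (fun x xN => esym (sum_kernelIII F l1 l2 l3 N x f xN))).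
  apply: expect_degreel => //; apply: expect_degreer => //; exact: degree_leX.
- apply: (eq_degree_le _ _ _ _ _ (fun x xN => esym (sum_kernelIV F l1 l2 l3 N x f xN))).
  apply: expect2_degree => //; exact: expect_eta_bidegree.
- apply: (eq_degree_le _ _ _ _ _ (fun x xN => esym (sum_kernelV F l1 l2 l3 N x f xN))).
  have {}FQ := FQ (or_intror erefl).
  apply: (additive_degree F N l1 n
    (fun f x => expect F l2 (fun u => expect F l3 f 0 u) 0 x)) => //.
    move=> i; apply: expect_degreer => //; apply: expect_degreer => //.
    exact: degree_leX.
  move=> z M; pose t i w := 'C(n, i)%:R * eta q F z ^+ (n - i) * eta q F w ^+ i.
  transitivity (expect F l2 (fun u => \sum_(i < n.+1) expect F l3 (t i) 0 u) 0 M).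
    apply: eq_expect => u _; rewrite -expect_sum; apply: eq_expect => w _.
    exact: eta_add_expn.
  rewrite [LHS](expect_sum _ _ _ (fun i u => expect F l3 (t i) 0 u)).
  apply: eq_bigr => i _; rewrite -expectZ; apply: eq_expect => u _.
  by rewrite -expectZ.
Qed.

End Measures.

Theorem mainTheorem1 (R : realType) (q : R) (hq : 0 < q < 1)
    (N : nat) (hN : (1 <= N)%N)
    (F : measure_family) (c : convolution_type) (hFc : allowed F c)
    (l1 l2 l3 : param R F)
    (hl1 : admissible l1) (hl2 : admissible l2) (hl3 : admissible l3) :
  exists a : nat -> nat -> R,
    forall n x : 'I_N.+1,
      \sum_(y < N.+1) kernel q c l1 l2 l3 N y x * eta q F y ^+ n =
      \sum_(m < n.+1) a n m * eta q F x ^+ m.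
Proof.
have /fin_all_exists [p pE] (n : 'I_N.+1) : exists p : {poly R},
    (size p <= n.+1)%N /\ forall x, (x <= N)%N ->
    \sum_(y < N.+1) kernel q c l1 l2 l3 N y x * eta q F y ^+ n = p.[eta q F x].
  have [p sp pE] := sum_kernel_degree R q hq F c l1 l2 l3 N n hFc hl1 hl2 hl3.
  by exists p.
(* [inord] is the identity on the [n] at hand; its default value is met only for [n > N]. *)
exists (fun n m => (p (inord n))`_m) => n x.
have [sp ->] := pE n; last by rewrite -ltnS.
by rewrite inord_val (horner_coef_wide _ sp).
Qed.
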